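(* Let $G$ be a locally compact Hausdorff abelian group, let $\mathcal{L}$ be a countably infinite lattice in $G$, and let $\psi\in \mathrm{L}^2(G)$ with $\|\psi\|_{\mathrm{L}^2(G)}\neq 0$. The system $\mathcal{F}_\psi=(T_k\psi)_{k\in\mathcal{L}}$ is democratic in $\mathrm{L}^2(G)$ if and only if there exist constants $c_\psi,C_\psi\in(0,+\infty)$ such that for every nonempty finite set $\Gamma\subset\mathcal{L}$ we have $$c_\psi\,\mathrm{card}\,\Gamma \;\leq\; \Big\|\sum_{k\in\Gamma} T_k\psi\Big\|_{\mathrm{L}^2(G)}^2 \;\leq\; C_\psi\,\mathrm{card}\,\Gamma.$$
   Context: The group $G$ is written additively, and $\mathrm{L}^2(G)$ is taken with respect to a Haar measure on $G$ (with the Borel $\sigma$-algebra). A lattice in $G$ is a closed subgroup $\mathcal{L}$ of $G$ whose relative topology is discrete and such that the quotient $G/\mathcal{L}$ is compact. For $y\in G$ and $f\in \mathrm{L}^2(G)$, the translate is $(T_yf)(x):=f(x-y)$. A family $\mathcal{F}=(f_k)_{k\in I}$ of nonzero vectors in a Banach space $(X,\|\cdot\|)$ is called democratic if there exists a constant $D\in(0,+\infty)$ such that for any two finite index sets $\Gamma_1,\Gamma_2\subseteq I$ of the same cardinality one has $$\Big\|\sum_{k\in\Gamma_1}\frac{f_k}{\|f_k\|}\Big\|\leq D\,\Big\|\sum_{k\in\Gamma_2}\frac{f_k}{\|f_k\|}\Big\|.$$ *)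

(* Defs.v *)
From HB Require Import structures.
From mathcomp Require Import all_boot all_order all_algebra finmap.
From mathcomp Require Import all_classical all_reals all_analysis.
From mathcomp Require Import measurable_realfun complex.

Set Implicit Arguments.
Unset Strict Implicit.
Unset Printing Implicit Defensive.

Import Order.TTheory GRing.Theory Num.Theory.
Import numFieldNormedType.Exports.
Import ComplexField.Normc.

Local Open Scope classical_set_scope.
Local Open Scope ring_scope.
Local Open Scope quotient_scope.

Section ComplexL2.
Context {d : measure_display} {T : measurableType d} {R : realType}.
Variable mu : {measure set T -> \bar R}.
Implicit Types f g : T -> R[i].

(* Borel measurability of a complex-valued function, through the homeomorphism
   of C with R x R. *)
Definition cmeasurable f :=
  measurable_fun [set: T] (fun x => complex.Re (f x)) /\
  measurable_fun [set: T] (fun x => complex.Im (f x)).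

Definition cLnorm2 f : \bar R := 'N[mu]_2%:E[EFin \o (fun x => normc (f x))].

Definition sqintegrable : {pred T -> R[i]} :=
  mem [set f | cmeasurable f /\ (cLnorm2 f < +oo)%E].

Lemma normc_ReIm (z : R[i]) :
  normc z = Num.sqrt (complex.Re z ^+ 2 + complex.Im z ^+ 2).
Proof. by case: z. Qed.

Lemma normc_ge0 (z : R[i]) : 0 <= normc z.
Proof. by rewrite normc_ReIm sqrtr_ge0. Qed.

Lemma cmeasurable_normc f : cmeasurable f ->
  measurable_fun [set: T] (fun x => normc (f x)).
Proof.
move=> [mr mi]; under eq_fun do rewrite normc_ReIm -powR12_sqrt ?addr_ge0 ?sqr_ge0//.
apply: (measurableT_comp (measurable_powR _)).
by apply: measurable_funD; exact: measurable_funX.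
Qed.

Lemma cLnorm2_fin f : f \in sqintegrable ->
  cLnorm2 f = (fine (cLnorm2 f))%:E.
Proof.
rewrite inE => -[_ foo]; rewrite fineK// fin_numElt foo andbT.
by rewrite (lt_le_trans _ (Lnorm_ge0 _ _ _)).
Qed.

Lemma cmeasurableD f g : cmeasurable f -> cmeasurable g -> cmeasurable (f + g).
Proof.
move=> [fr fi] [gr gi]; split.
- rewrite (_ : (fun x => _) = (fun x => complex.Re (f x)) \+ (fun x => complex.Re (g x))).
    exact: measurable_funD.
  by apply/funext => x; rewrite /GRing.add/=; case: (f x) (g x) => [? ?] [].
- rewrite (_ : (fun x => _) = (fun x => complex.Im (f x)) \+ (fun x => complex.Im (g x))).
    exact: measurable_funD.
  by apply/funext => x; rewrite /GRing.add/=; case: (f x) (g x) => [? ?] [].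
Qed.

Lemma cmeasurableZ a f : cmeasurable f -> cmeasurable (a *: f).
Proof.
move=> [fr fi]; case: a => a b; split.
- rewrite (_ : (fun x => _) =
      (fun x => a * complex.Re (f x)) \- (fun x => b * complex.Im (f x))).
    by apply: measurable_funB; exact: measurable_funM.
  by apply/funext => x; rewrite /GRing.scale/=; case: (f x).
- rewrite (_ : (fun x => _) =
      (fun x => a * complex.Im (f x)) \+ (fun x => b * complex.Re (f x))).
    by apply: measurable_funD; exact: measurable_funM.
  by apply/funext => x; rewrite /GRing.scale/=; case: (f x).
Qed.

Lemma cLnorm2D f g : cmeasurable f -> cmeasurable g ->
  (cLnorm2 (f + g)%R <= cLnorm2 f + cLnorm2 g)%E.
Proof.
move=> mf mg.
have nf := cmeasurable_normc mf; have ng := cmeasurable_normc mg.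
have nfg := cmeasurable_normc (cmeasurableD mf mg).
have := @minkowski_EFin _ _ _ mu _ _ 2 nf ng.
rewrite ler1n => /(_ isT); apply: le_trans.
rewrite /cLnorm2 unlock gt0_ler_poweR ?invr_ge0//.
- by rewrite in_itv/= leey integral_ge0// => x _; rewrite poweR_ge0.
- by rewrite in_itv/= leey integral_ge0// => x _; rewrite poweR_ge0.
apply: ge0_le_integral => //.
- by move=> x _; rewrite poweR_ge0.
- apply: (measurableT_comp (measurable_poweR _)).
  exact/measurableT_comp/measurable_EFinP.
- apply: (measurableT_comp (measurable_poweR _)).
  apply/measurableT_comp => //; apply/measurable_EFinP.
  exact: measurable_funD.
move=> x _; rewrite lee_fin ge0_ler_powR ?nnegrE//.
rewrite !ger0_norm ?addr_ge0 ?normc_ge0//.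
exact: le_normcD.
Qed.

Lemma cLnorm2Z (a : R[i]) f : f \in sqintegrable ->
  cLnorm2 (a *: f) = ((normc a)%:E * cLnorm2 f)%E.
Proof.
rewrite inE => -[mf ffin].
have nf : (fun x => normc (f x)) \in Lfun mu 2%:E.
  by rewrite inE; apply/andP; split; rewrite inE//; exact: cmeasurable_normc.
have := @LnormZ _ _ _ mu 2%:E (lee1n 2) (Lfun_Sub (lee1n 2) nf) (normc a).
rewrite ger0_norm ?normc_ge0//; rewrite /cLnorm2 => <-.
by apply: eq_Lnorm => x /=; rewrite normcM.
Qed.

Fact sqintegrable_submod_closed : submod_closed sqintegrable.
Proof.
split.
  rewrite inE; split.
    by split; exact: measurable_cst.
  suff -> : cLnorm2 0 = 0%E by [].
  rewrite -[RHS](@Lnorm0 _ _ _ mu 2%:E) ?eqe ?pnatr_eq0//.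
  by apply: eq_Lnorm => x; congr EFin; exact: normc0.
move=> a f g fL gL; have := fL; have := gL.
rewrite !inE => -[mg ng] [mf nf]; split.
  exact/cmeasurableD/mg/cmeasurableZ.
apply: le_lt_trans (cLnorm2D _ _) _ => //; first exact: cmeasurableZ.
by rewrite cLnorm2Z// lte_add_pinfty// lte_mul_pinfty// lee_fin normc_ge0.
Qed.
HB.instance Definition _ :=
  GRing.isSubmodClosed.Build _ _ sqintegrable sqintegrable_submod_closed.

Record sqfun := SqFun { sqfun_val :> T -> R[i]; _ : sqfun_val \in sqintegrable }.
HB.instance Definition _ := [isSub for sqfun_val].
HB.instance Definition _ := [Choice of sqfun by <:].
HB.instance Definition _ := [SubChoice_isSubLmodule of sqfun by <:].

Lemma sqfunP (f : sqfun) : (f : T -> R[i]) \in sqintegrable.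
Proof. by case: f. Qed.

Definition null_sqfun : {pred sqfun} :=
  mem [set f : sqfun | {ae mu, forall x, f x = 0}].

Fact null_sqfun_zmod_closed : zmod_closed null_sqfun.
Proof.
split; first by rewrite inE/=; apply: aeW.
move=> f g; rewrite !inE/= => f0 g0.
apply: filterS2 f0 g0 => x fx gx.
by rewrite -[LHS]/(f x - g x) fx gx subrr.
Qed.
HB.instance Definition _ :=
  GRing.isZmodClosed.Build _ null_sqfun null_sqfun_zmod_closed.

(* L2 mu is the space of complex square-integrable functions modulo the
   subgroup of functions vanishing mu-almost everywhere. *)
Definition L2 : Type := Quotient.quot null_sqfun.
HB.instance Definition _ := EqQuotient.on L2.
HB.instance Definition _ := GRing.Zmodule.on L2.

Lemma null_sqfunZ (a : R[i]) (f : sqfun) :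
  f \in null_sqfun -> a *: f \in null_sqfun.
Proof.
rewrite !inE/=; apply: filterS => x fx0.
by rewrite -[LHS]/(a * f x) fx0 mulr0.
Qed.

Lemma null_sqfun_norm (f : sqfun) : (f \in null_sqfun) = (cLnorm2 f == 0%E).
Proof.
have := sqfunP f; rewrite !inE => -[mf _].
have nf := cmeasurable_normc mf.
apply/idP/eqP.
  rewrite inE/= => f0; rewrite /cLnorm2 unlock/=.
  rewrite (ae_eq_integral (cst 0%E)) ?integral0 ?poweR0r//.
  - apply/measurable_EFinP/(measurableT_comp (measurable_powR _)).
    exact: measurableT_comp.
  - apply: filterS f0 => x -> _; rewrite [normc _]normc0 normr0 powR0//.
have nf' : measurable_fun [set: T] (EFin \o (fun x => normc (f x))).
  exact/measurable_EFinP.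
move=> N0; have p0 : (0 < 2%:E :> \bar R)%E by rewrite lte_fin.
have := Lnorm_eq0_eq0 nf' p0 N0.
rewrite inE/=; apply: filterS => x /(_ I) /= => -[] fx0.
exact: (@eq0_normc R _ fx0).
Qed.

Lemma le_cLnorm2_ae (f g : sqfun) :
  f - g \in null_sqfun -> (cLnorm2 f <= cLnorm2 g)%E.
Proof.
rewrite null_sqfun_norm => /eqP fg0.
rewrite (_ : sqfun_val f = sqfun_val (f - g) + sqfun_val g); last first.
  by rewrite -[RHS]/(sqfun_val ((f - g) + g)) subrK.
apply: le_trans (cLnorm2D _ _) _; last by rewrite fg0 add0e.
- by have := sqfunP (f - g); rewrite inE => -[].
- by have := sqfunP g; rewrite inE => -[].
Qed.

Lemma eq_cLnorm2_ae (f g : sqfun) :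
  f - g \in null_sqfun -> cLnorm2 f = cLnorm2 g.
Proof.
move=> fg; apply/eqP; rewrite eq_le !le_cLnorm2_ae//.
by rewrite -opprB rpredN.
Qed.

Definition L2_scale (a : R[i]) (u : L2) : L2 := \pi_L2 (a *: repr u).

Lemma pi_L2_scale a (f : sqfun) : \pi_L2 (a *: f) = L2_scale a (\pi_L2 f).
Proof.
apply/eqP; rewrite /L2_scale -Quotient.idealrBE -scalerBr null_sqfunZ//.
by rewrite Quotient.idealrBE reprK.
Qed.

Fact L2_scalerA a b u : L2_scale a (L2_scale b u) = L2_scale (a * b) u.
Proof.
elim/quotW: u => f.
by rewrite -(pi_L2_scale b f) -(pi_L2_scale a) -(pi_L2_scale (a * b)) scalerA.
Qed.

Fact L2_scale1r : left_id 1 L2_scale.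
Proof. by elim/quotW => f; rewrite -(pi_L2_scale 1 f) scale1r. Qed.

Fact L2_scalerDr : right_distributive L2_scale +%R.
Proof.
move=> a; elim/quotW => f; elim/quotW => g.
rewrite -(pi_L2_scale a f) -(pi_L2_scale a g) -2!raddfD.
by rewrite -(pi_L2_scale a (f + g)) scalerDr.
Qed.

Fact L2_scalerDl u : {morph L2_scale^~ u : a b / a + b}.
Proof.
elim/quotW: u => f a b.
by rewrite -(pi_L2_scale a f) -(pi_L2_scale b f) -(pi_L2_scale (a + b) f)
  -raddfD scalerDl.
Qed.

HB.instance Definition _ := GRing.Zmodule_isLmodule.Build R[i] L2
  L2_scalerA L2_scale1r L2_scalerDr L2_scalerDl.

(* A normedModType over R[i] has its norm valued in R[i]: the real L2-norm is
   embedded there. *)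
Definition L2_norm (u : L2) : R[i] := (fine (cLnorm2 (repr u)))%:C%C.

Lemma L2_norm_pi (f : sqfun) : L2_norm (\pi_L2 f) = (fine (cLnorm2 f))%:C%C.
Proof.
rewrite /L2_norm (@eq_cLnorm2_ae _ f)//.
by rewrite Quotient.idealrBE reprK.
Qed.

Fact L2_normD u v : L2_norm (u + v) <= L2_norm u + L2_norm v.
Proof.
rewrite -[u]reprK -[v]reprK -raddfD !L2_norm_pi -rmorphD lecR -lee_fin EFinD.
rewrite -!cLnorm2_fin ?sqfunP//.
by apply: cLnorm2D; [have := sqfunP (repr u) | have := sqfunP (repr v)];
  rewrite inE => -[].
Qed.

Fact L2_normZ (a : R[i]) u : L2_norm (a *: u) = `|a| * L2_norm u.
Proof.
rewrite -[u]reprK -[a *: _]pi_L2_scale !L2_norm_pi.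
rewrite -[LHS]/((fine (cLnorm2 (a *: (repr u : T -> R[i]))))%:C)%C cLnorm2Z ?sqfunP//.
rewrite (cLnorm2_fin (sqfunP _))/= rmorphM/=.
by congr (_ * _); rewrite normc_def normc_ReIm.
Qed.

Fact L2_norm0_eq0 u : L2_norm u = 0 -> u = 0.
Proof.
rewrite -[u]reprK L2_norm_pi => -[] u0; have {u0} := congr1 EFin u0.
rewrite -(cLnorm2_fin (sqfunP _)) => /eqP; rewrite -null_sqfun_norm => u0.
by rewrite -(raddf0 \pi_L2); apply/eqP; rewrite -Quotient.idealrBE subr0.
Qed.

HB.instance Definition _ := @Lmodule_isNormed.Build R[i] L2
  L2_norm L2_normD L2_normZ L2_norm0_eq0.

End ComplexL2.
Arguments L2 {d T R} mu.

(* G with its Borel sigma-algebra. The alias is needed because measurable types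
   are pointed, which topological groups are not a priori; 0 is the point. *)
Definition borel (G : topologicalZmodType) : Type := G.

Section Borel.
Variable G : topologicalZmodType.
HB.instance Definition _ := TopologicalZmodule.copy (borel G) G.
HB.instance Definition _ := isPointed.Build (borel G) 0.
HB.instance Definition _ := @isMeasurable.Build (sigma_display (@open G))
  (borel G) <<s @open G >> (@sigma_algebra0 _ setT (@open G))
  (@sigma_algebraC (borel G) (@open G)) (@sigma_algebra_bigcup _ setT (@open G)).

Lemma open_borel (U : set G) : open U -> measurable (U : set (borel G)).
Proof. exact: sub_sigma_algebra. Qed.

Lemma measurable_sub_borel (y : G) :
  measurable_fun [set: borel G] ((fun x => x - y) : borel G -> borel G).
Proof.
apply: (@measurability _ _ (borel G) (borel G) _ _ (@open G)) => //.
move=> _ [U oU <-]; rewrite setTI; apply: open_borel.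
apply: open_comp oU => x _.
apply: (@continuous_comp _ _ _ (fun x : G => (x, y)) (fun z => z.1 - z.2)).
  by apply: cvg_pair; [exact: cvg_id|exact: cvg_cst].
exact: sub_continuous.
Qed.
End Borel.

(* A Haar measure: a nonzero translation-invariant Radon measure, with the usual
   convention on regularity (outer regular on Borel sets, inner regular on open
   sets). *)
Record haarMeasure (R : realType) (G : topologicalZmodType) := HaarMeasure {
  haar :> {measure set (borel G) -> \bar R} ;
  haar_translation : forall (y : G) (A : set (borel G)), measurable A ->
    haar [set x + y | x in A] = haar A ;
  haar_neq0 : haar [set: borel G] != 0%E ;
  haar_compact : forall K : set G, compact K -> (haar K < +oo)%E ;
  haar_outer : forall A : set (borel G), measurable A ->
    haar A = ereal_inf [set haar U | U in [set U : set G | open U /\ A `<=` U]] ;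
  haar_inner : forall U : set G, open U ->
    haar U = ereal_sup [set haar K | K in [set K : set G | compact K /\ K `<=` U]]
}.

Section Translation.
Context {R : realType} {G : topologicalZmodType} (mu : haarMeasure R G).

Lemma haar_sub (y : G) (A : set (borel G)) : measurable A ->
  mu ((fun x : G => x - y) @^-1` A) = mu A.
Proof.
move=> mA; rewrite -[RHS](haar_translation mu y mA); congr (mu _).
apply/seteqP; split=> [x Ax|_ [x Ax <-]].
  by exists (x - y) => //; exact: subrK.
by rewrite /preimage/= [X in A X](_ : _ = x)//; exact: addrK.
Qed.

Lemma haar_integral_sub (y : G) (h : borel G -> \bar R) :
  measurable_fun [set: borel G] h -> (forall x, 0 <= h x)%E ->
  (\int[mu]_x h ((x : G) - y)%R = \int[mu]_x h x)%E.
Proof.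
move=> mh h0.
have := @ge0_integral_pushforward _ _ _ _ R _ (measurable_sub_borel y) mu setT h
  measurableT mh (fun x _ => h0 x).
rewrite preimage_setT => <-.
apply: eq_measure_integral => [|mphi A mA _]; first exact: measurable_sub_borel.
exact: haar_sub.
Qed.

Lemma cLnorm2_translate (y : G) (f : G -> R[i]) : cmeasurable (f : borel G -> _) ->
  cLnorm2 mu (fun x : borel G => f ((x : G) - y)) = cLnorm2 mu f.
Proof.
move=> /cmeasurable_normc mf; rewrite /cLnorm2 unlock; congr (_ `^ _)%E.
apply: (@haar_integral_sub y (fun x => `|(normc (f x))%:E| `^ 2)%E).
  apply: (measurableT_comp (measurable_poweR _)).
  exact/measurableT_comp/measurable_EFinP.
by move=> x; exact: poweR_ge0.
Qed.

Lemma sqintegrable_translate (y : G) (f : sqfun mu) :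
  (fun x : borel G => f ((x : G) - y)) \in sqintegrable mu.
Proof.
have := sqfunP f; rewrite !inE => -[mf ffin]; split; last first.
  by rewrite cLnorm2_translate.
by case: mf => mr mi; split; [apply: (measurableT_comp mr)|apply: (measurableT_comp mi)];
  exact: measurable_sub_borel.
Qed.

Definition sqfun_translate (y : G) (f : sqfun mu) : sqfun mu :=
  SqFun (sqintegrable_translate y f).

(* (translate y u)(x) = u(x - y); see translate_pi for the independence of the
   chosen representative. *)
Definition translate (y : G) (u : L2 mu) : L2 mu :=
  \pi_(L2 mu) (sqfun_translate y (repr u)).

Lemma translate_pi (y : G) (f : sqfun mu) :
  translate y (\pi_(L2 mu) f) = \pi_(L2 mu) (sqfun_translate y f).
Proof.
apply/eqP; rewrite -Quotient.idealrBE null_sqfun_norm.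
rewrite (_ : _ - _ = sqfun_translate y (repr (\pi_(L2 mu) f) - f)); last exact: val_inj.
rewrite cLnorm2_translate -?null_sqfun_norm ?Quotient.idealrBE ?reprK//.
by have := sqfunP (repr (\pi_(L2 mu) f) - f); rewrite inE => -[].
Qed.

End Translation.

(* zmodClosed G is the type of (predicates defining) subgroups of G;
   [set` L] carries the relative topology. *)
Record is_lattice (G : topologicalZmodType) (L : zmodClosed G) : Prop := IsLattice {
  lattice_closed : closed [set` L] ;
  lattice_discrete : forall A : set [set` L], open A ;
  lattice_cocompact : compact [set: quotient_topology (Quotient.quot L)]
}.

Definition translates (R : realType) (G : topologicalZmodType)
    (mu : haarMeasure R G) (L : zmodClosed G) (psi : L2 mu) :
    [set` L] -> L2 mu :=
  fun k => translate (\val k) psi.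
Arguments translates {R G mu} L psi k.

(* K is R or C; in the latter case 0 < D forces D to be a (positive) real. *)
Definition democratic (K : numFieldType) (X : normedModType K) (I : choiceType)
    (f : I -> X) : Prop :=
  (forall k, f k != 0) /\
  exists2 D : K, 0 < D & forall A B : {fset I}, #|` A| = #|` B| ->
    `|\sum_(k <- A) `|f k|^-1 *: f k| <= D * `|\sum_(k <- B) `|f k|^-1 *: f k|.

(* Main.v *)
Require Import Defs.
From mathcomp Require Import all_boot all_order all_algebra finmap.
From mathcomp Require Import all_classical all_reals all_analysis.
From mathcomp Require Import measurable_realfun complex lra.

Set Implicit Arguments.
Unset Strict Implicit.
Unset Printing Implicit Defensive.

Import Order.TTheory GRing.Theory Num.Theory.
Import numFieldNormedType.Exports.
Import ComplexField.Normc.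
Local Open Scope classical_set_scope.
Local Open Scope ring_scope.


(** All translates of [psi] have the norm of [psi], so democracy says that
    the norms of sums of equally many translates are comparable up to a fixed
    factor. The two-sided estimate clearly implies this. For the converse it
    suffices to exhibit, for each [n], one set of [n] translates whose sum has
    norm comparable to [sqrt n * `|psi|]; democracy then transports that
    estimate to every set of [n] translates.

    Such a set exists because far-apart translates are almost orthogonal
    ([almost_orthogonal_translates]). Haar measure is regular enough that
    [psi] is within any [d > 0] of a function [f] vanishing outside a compact
    set ([L2_compact_support_dense]). A compact set meets the lattice in
    finitely many points ([lattice_compact_finite]), whereas the lattice is
    infinite, so one can choose successively [n] translates of [f] with
    disjoint supports ([disjoint_translates]); by Pythagoras their sum has norm
    exactly [sqrt n] times that of [f]. Replacing [f] by [psi] costs at most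
    [n * d] by the triangle inequality, and [d] is chosen after [n]. This
    crude estimate takes the place of the decay at infinity of the inner
    products of [psi] with its translates. *)

(** * Compact sets and the lattice *)

(** Each lattice point is isolated from the others by an open set of [G], and
    finitely many of these open sets cover the compact set [K `&` L]. *)
Lemma lattice_compact_finite (G : topologicalZmodType) (L : zmodClosed G)
    (latL : is_lattice L) (K : set G) :
  compact K -> finite_set [set k : [set` L] | K (\val k)].
Proof.
(* [borel G] is [G] with a base point, as [compact_cover] requires. *)
move=> cK; have : @compact (borel G) (K `&` [set` L]).
  exact: compact_closedI (lattice_closed latL).
have sep (l : [set` L]) : exists U : set G,
    [/\ open U, U (\val l) & forall k : [set` L], U (\val k) -> k = l].
  have [U oU UE] := lattice_discrete latL [set l].
  exists U; split=> [//||k Uk].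
    by have : (set_val @^-1` U) l by rewrite UE.
  by have : [set l] k by rewrite -UE.
have [U UP] := choice sep.
rewrite compact_cover => /(_ [set` L] setT U)[].
- by move=> l _; have [] := UP l.
- move=> x [_ Lx]; exists (SigSub (mem_set Lx)) => //.
  by have [_] := UP (SigSub (mem_set Lx)).
move=> D _ KD; apply: sub_finite_set (finite_fset D) => k Kk.
have [|l Dl Ul] := KD (\val k); first by split=> //; exact: set_valP.
by have [_ _ /(_ k Ul)->] := UP l.
Qed.

(** The points [k] for which [K + k] meets [C] lie in the compact set [C - K]. *)
Lemma lattice_escape (G : topologicalZmodType) (L : zmodClosed G)
    (latL : is_lattice L) (infL : infinite_set [set` L])
    (B : {fset [set` L]}) (C K : set G) :
  compact C -> compact K ->
  exists2 k : [set` L], k \notin B & forall x : G, C x -> ~ K (x - \val k).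
Proof.
move=> cC cK.
pose CK : set G := [set z.1 - z.2 | z in C `*` K].
have cCK : compact CK.
  apply: continuous_compact (compact_setX cC cK).
  by apply: continuous_subspaceT; exact: sub_continuous.
have infT : infinite_set [set: [set` L]].
  apply: contra_not infL => finT.
  apply: sub_finite_set (finite_image \val finT) => x Lx.
  by exists (SigSub (mem_set Lx)).
have finS : finite_set ([set` B] `|` [set k : [set` L] | CK (\val k)]).
  rewrite finite_setU; split; first exact: finite_fset.
  exact: lattice_compact_finite.
have [k [_ /not_orP[kB kCK]]] := infinite_setN0 (infinite_setD infT finS).
exists k; first exact/negP.
move=> x Cx Kx; apply: kCK; exists (x, x - \val k) => //=.
by rewrite opprB addrC subrK.
Qed.

(** * Tightness of integrable densities *)

Lemma compact_borel (G : topologicalZmodType) (hausdorffG : hausdorff_space G)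
    (K : set G) : compact K -> measurable (K : set (borel G)).
Proof.
move=> cK; rewrite -[K]setCK; apply: measurableC; apply: open_borel.
exact: closed_openC (compact_closed hausdorffG cK).
Qed.

(** The measure need not be sigma-finite, but the level sets
    [A m = {1/(m+1) <= h <= m+1}] have finite measure, and they exhaust the
    integral of [h]. Once [A m] carries all but [e/2] of it, outer regularity
    puts [A m] in an open set [U] of finite measure and inner regularity of [U]
    gives [K]. Inner regularity of [A m] itself is avoided: [K] need not lie in
    [A m], it only has to leave a set of small measure in [U], where
    [h <= m+1] bounds the integral over [A m `\` K]. *)
Lemma haar_integral_compact_tail (R : realType) (G : topologicalZmodType)
    (hausdorffG : hausdorff_space G) (mu : haarMeasure R G) (h : borel G -> R)
    (mh : measurable_fun [set: borel G] h) (h0 : forall x, 0 <= h x)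
    (hoo : (\int[mu]_x (h x)%:E < +oo)%E) (e : R) (e0 : 0 < e) :
  exists2 K : set G, compact K & (\int[mu]_(x in ~` K) (h x)%:E <= e%:E)%E.
Proof.
have mhE (D : set (borel G)) : measurable_fun D (EFin \o h).
  by apply: measurable_funTS; exact/measurable_EFinP.
have hE0 (D : set (borel G)) x : D x -> (0 <= (h x)%:E)%E.
  by move=> _; rewrite lee_fin.
have e20 : 0 < e / 2 by rewrite divr_gt0.
pose A (m : nat) : set (borel G) := h @^-1` `[m.+1%:R^-1, m.+1%:R].
have mA m : measurable (A m).
  by rewrite -[A m]setTI; exact: mh.
have ndA : {homo A : n m / (n <= m)%N >-> (n <= m)%O}.
  move=> n m nm; apply/subsetPset => x; rewrite /A/= !in_itv/= => /andP[hn nh].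
  rewrite (le_trans _ hn) ?(le_trans nh) ?ler_nat//.
  by rewrite lef_pV2 ?posrE// ler_nat.
have hUA : (\int[mu]_x (h x)%:E = \int[mu]_(x in \bigcup_m A m) (h x)%:E)%E.
  rewrite [RHS]integral_mkcond; apply: eq_integral => x _.
  rewrite patchE; case: ifPn => //; rewrite notin_setE => nAx.
  apply/eqP; rewrite eqe eq_le h0 andbT leNgt; apply/negP => hx.
  apply: nAx; pose m := maxn (Num.truncn (h x)) (Num.truncn (h x)^-1).
  exists m => //; rewrite /A/= in_itv/= invf_ple ?posrE//.
  by rewrite !ltW// -truncn_le_nat leq_max leqnn ?orbT.
have intfin : (\int[mu]_x (h x)%:E)%E \is a fin_num.
  by rewrite ge0_fin_numE ?integral_ge0// => x _; exact: (hE0 setT).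
have [m Am] : exists m, (\int[mu]_(x in ~` A m) (h x)%:E <= (e / 2)%:E)%E.
  have := @ge0_nondecreasing_set_cvg_integral _ _ _ A (EFin \o h) mu
    ndA mA (fun=> mhE _) (fun m => hE0 (A m)).
  rewrite -hUA => /(_ [set y | (\int[mu]_x (h x)%:E) - (e / 2)%:E < y]%E)[].
    apply: open_nbhs_nbhs; split; first exact: open_ereal_gt_ereal.
    by rewrite /= EFinN lteBlDr// lteDl// lte_fin.
  move=> m _ /(_ m (leqnn m)) /= Am; exists m.
  have := @ge0_integral_setU _ _ _ mu _ _ (mA m) (measurableC (mA m)) (EFin \o h)
    (mhE _) (hE0 _).
  rewrite setUCr => IE.
  have Afin : (\int[mu]_(x in A m) (h x)%:E)%E \is a fin_num.
    rewrite ge0_fin_numE; last by apply: integral_ge0 => x; exact: hE0.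
    apply: le_lt_trans hoo.
    by apply: ge0_subset_integral => // x; exact: hE0.
  move: Am; rewrite EFinN lteBlDr// IE; first by rewrite lteD2lE// => /ltW.
  exact/disj_setPCl.
have muA : (mu (A m) < +oo)%E.
  suff : (m.+1%:R^-1%:E * mu (A m) <= \int[mu]_x (h x)%:E)%E.
    move=> /le_lt_trans/(_ hoo); rewrite !ltey; apply: contra => /eqP->.
    by rewrite gt0_muley// lte_fin invr_gt0.
  rewrite -integral_cst//.
  apply: (@le_trans _ _ (\int[mu]_(x in A m) (h x)%:E)%E).
    apply: ge0_le_integral => //.
    - by move=> x _; rewrite lee_fin.
    - by move=> x; rewrite /A/= in_itv/= lee_fin => /andP[].
  by apply: ge0_subset_integral => // x; exact: hE0.
have [U [oU AU] muU] : exists2 U : set G, open U /\ A m `<=` U & (mu U < +oo)%E.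
  move: muA; rewrite haar_outer// => /ereal_inf_lt[_ [U [oU AU] <-] Uoo].
  by exists U.
have mU := open_borel oU.
pose d := e / 2 / m.+1%:R.
have [K [cK KU] muK] : exists2 K : set G, compact K /\ K `<=` U &
    (mu (U `\` K : set (borel G)) <= d%:E)%E.
  have d0 : 0 < d by rewrite divr_gt0.
  have Ufin : mu U \is a fin_num by rewrite ge0_fin_numE.
  have := Ufin; rewrite {1}haar_inner// => /(ub_ereal_sup_adherent d0).
  rewrite -haar_inner// => -[_ [K [cK KU] <-] Kd].
  exists K => //; have mK := compact_borel hausdorffG cK.
  rewrite measureD// setIidr//.
  have Kfin : mu K \is a fin_num by rewrite ge0_fin_numE ?haar_compact.
  by rewrite leeBlDr// addeC -leeBlDr// ltW.
have mK := compact_borel hausdorffG cK; exists K => //.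
apply: (@le_trans _ _ (\int[mu]_(x in ~` A m `|` (A m `\` K)) (h x)%:E)%E).
  apply: ge0_subset_integral => //.
  - exact: measurableC.
  - by apply: measurableU; [exact: measurableC|exact: measurableD].
  - by move=> x; exact: hE0.
  - by move=> x Kx; have [Ax|] := pselect (A m x); [right|left].
rewrite ge0_integral_setU//; last 4 first.
- exact: measurableC.
- exact: measurableD.
- by move=> x; exact: hE0.
- by apply/disj_set2P; rewrite setDE setIA setICl set0I.
rewrite [e]splitr EFinD leeD//.
apply: (@le_trans _ _ (\int[mu]_(x in A m `\` K) (cst m.+1%:R%:E x))%E).
  apply: ge0_le_integral => //.
  - exact: measurableD.
  - by move=> x; exact: hE0.
  - by move=> x [+ _]; rewrite /A/= in_itv/= lee_fin => /andP[].
rewrite integral_cst//; last exact: measurableD.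
apply: (@le_trans _ _ (m.+1%:R%:E * d%:E)%E).
  apply: lee_wpmul2l => //.
  apply: le_trans muK; apply: le_measure; rewrite ?inE; try exact: measurableD.
  by move=> x [Ax Kx]; split=> //; exact: AU.
by rewrite -EFinM lee_fin /d mulrC divfK.
Qed.

(** * The real-valued norm and orthogonality *)

Lemma cLnorm2_sq (R : realType) d (T : measurableType d)
    (mu : {measure set T -> \bar R}) (f : T -> R[i]) :
  (cLnorm2 mu f `^ 2)%E = (\int[mu]_x (normc (f x) ^+ 2)%:E)%E.
Proof.
rewrite /cLnorm2 poweR_Lnorm//; apply: eq_integral => x _ /=.
by rewrite powR_mulrn ?normr_ge0// ger0_norm ?normc_ge0.
Qed.

Lemma sqintegrable_of_integral (R : realType) d (T : measurableType d)
    (mu : {measure set T -> \bar R}) (f : T -> R[i]) : cmeasurable f ->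
  (\int[mu]_x (normc (f x) ^+ 2)%:E < +oo)%E -> f \in sqintegrable mu.
Proof.
move=> mf foo; rewrite inE; split=> //.
rewrite ltey; apply: contraTN foo => /eqP.
rewrite -cLnorm2_sq => ->.
by rewrite poweRyr.
Qed.

(** The norm of [L2 mu] takes its values in [R[i]], where the order is only
    partial; [L2norm] is the same norm as an element of [R]. *)
Definition L2norm (R : realType) d (T : measurableType d)
  (mu : {measure set T -> \bar R}) (u : L2 mu) : R := complex.Re `|u|.

Section L2norm.
Local Open Scope quotient_scope.
Context (R : realType) d (T : measurableType d)
  (mu : {measure set T -> \bar R}).
Implicit Types (u v : L2 mu) (f g : sqfun mu).

Lemma normL2E u : `|u| = (L2norm u)%:C%C.
Proof. by []. Qed.

Lemma L2norm_ge0 u : 0 <= L2norm u.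
Proof. by rewrite -lecR -normL2E; exact: normr_ge0. Qed.

Lemma L2normD u v : L2norm (u + v) <= L2norm u + L2norm v.
Proof. by rewrite -lecR rmorphD/= -!normL2E ler_normD. Qed.

Lemma L2norm_dist u v : `|L2norm u - L2norm v| <= L2norm (u - v).
Proof.
have NB : L2norm (u - v) = L2norm (v - u) by rewrite /L2norm distrC.
rewrite ler_distl lerBlDr {1}NB; apply/andP; split.
- by have := L2normD (v - u) u; rewrite subrK addrC.
- by have := L2normD (u - v) v; rewrite subrK addrC.
Qed.

Lemma L2norm_sum (I : Type) (s : seq I) (F : I -> L2 mu) :
  L2norm (\sum_(i <- s) F i) <= \sum_(i <- s) L2norm (F i).
Proof. by rewrite -lecR rmorph_sum/= -normL2E ler_norm_sum. Qed.

Lemma L2norm_sq f :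
  (L2norm (\pi_(L2 mu) f) ^+ 2)%:E = (\int[mu]_x (normc (f x) ^+ 2)%:E)%E.
Proof.
rewrite -cLnorm2_sq (cLnorm2_fin (sqfunP f)) poweR_EFin powR_mulrn; last first.
  by rewrite fine_ge0 ?Lnorm_ge0.
by have /(congr1 (@complex.Re R))/= := L2_norm_pi f => <-.
Qed.

Lemma measurable_normc_sq f :
  measurable_fun [set: T] (fun x => normc (f x) ^+ 2).
Proof.
have := sqfunP f; rewrite inE => -[mf _].
exact: measurable_funX (cmeasurable_normc mf).
Qed.

Lemma sqfun_normc_sq_lty f : (\int[mu]_x (normc (f x) ^+ 2)%:E < +oo)%E.
Proof. by rewrite -L2norm_sq ltry. Qed.

Lemma L2norm_pythagoras f g : (forall x, f x = 0 \/ g x = 0) ->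
  L2norm (\pi_(L2 mu) (f + g)) ^+ 2 =
  L2norm (\pi_(L2 mu) f) ^+ 2 + L2norm (\pi_(L2 mu) g) ^+ 2.
Proof.
move=> fg0; apply: EFin_inj; rewrite EFinD !L2norm_sq -ge0_integralD//.
- apply: eq_integral => x _; rewrite -EFinD; congr EFin.
  rewrite -[sqfun_val (f + g) x]/(f x + g x).
  by case: (fg0 x) => ->; rewrite normc0 expr0n/= ?(add0r, addr0).
- by move=> x _; rewrite lee_fin sqr_ge0.
- by apply/measurable_EFinP; exact: measurable_normc_sq.
- by move=> x _; rewrite lee_fin sqr_ge0.
- by apply/measurable_EFinP; exact: measurable_normc_sq.
Qed.

End L2norm.

(** * Translates and compactly supported approximation *)

Section translates.
Local Open Scope quotient_scope.
Context (R : realType) (G : topologicalZmodType) (mu : haarMeasure R G).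
Implicit Types (u v : L2 mu) (y : G).

Lemma translateB y u v : translate y (u - v) = translate y u - translate y v.
Proof.
rewrite -[u]reprK -[v]reprK -raddfB !translate_pi -raddfB; congr (\pi _).
exact: val_inj.
Qed.

Lemma L2norm_translate y u : L2norm (translate y u) = L2norm u.
Proof.
rewrite -[u]reprK translate_pi.
apply/eqP; rewrite -(@eqrXn2 _ 2) ?L2norm_ge0// -eqe !L2norm_sq; apply/eqP.
apply: (@haar_integral_sub _ _ mu y (fun x => (normc (repr u x) ^+ 2)%:E)).
  by apply/measurable_EFinP; exact: measurable_normc_sq.
by move=> x; rewrite lee_fin sqr_ge0.
Qed.

Lemma L2_compact_support_dense (hausdorffG : hausdorff_space G) u (e : R) :
  0 < e -> exists (K : set G) (f : sqfun mu),
    [/\ compact K, forall x, ~ K x -> f x = 0 &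
        L2norm (u - \pi_(L2 mu) f) <= e].
Proof.
move=> e0; pose g : sqfun mu := repr u.
have [|K cK Ke] := haar_integral_compact_tail hausdorffG
  (measurable_normc_sq g) (fun x => sqr_ge0 _) (sqfun_normc_sq_lty g)
  (e := e ^+ 2).
  by rewrite exprn_gt0.
have mK := compact_borel hausdorffG cK.
pose KB : set (borel G) := K; pose h : borel G -> R[i] := patch (fun=> 0) KB g.
have mh : cmeasurable h.
  have := sqfunP g; rewrite inE => -[[mRe mIm] _].
  split.
  - rewrite (_ : (fun x => _) = (fun x => complex.Re (g x)) \_ KB).
      by apply/(measurable_restrictT _ mK); exact: measurable_funTS.
    by apply/funext => x; rewrite /h /patch; case: ifP.
  - rewrite (_ : (fun x => _) = (fun x => complex.Im (g x)) \_ KB).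
      by apply/(measurable_restrictT _ mK); exact: measurable_funTS.
    by apply/funext => x; rewrite /h /patch; case: ifP.
have hL : h \in sqintegrable mu.
  apply: (sqintegrable_of_integral mh); apply: le_lt_trans (sqfun_normc_sq_lty g).
  apply: ge0_le_integral => //.
  - by move=> x _; rewrite lee_fin sqr_ge0.
  - by apply/measurable_EFinP/measurable_funX; exact: cmeasurable_normc.
  - by apply/measurable_EFinP; exact: measurable_normc_sq.
  - move=> x _; rewrite lee_fin /h /patch; case: ifP => // _.
    by rewrite normc0 expr0n sqr_ge0.
exists K, (SqFun hL); split=> //.
  by move=> x Kx /=; rewrite /h /patch memNset.
rewrite -(@ler_pXn2r _ 2) ?nnegrE ?L2norm_ge0 ?(ltW e0)//.
rewrite -[u]reprK -raddfB -lee_fin L2norm_sq (le_trans _ Ke)//.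
rewrite [leRHS]integral_mkcond.
(* Pointwise, [`|g - h|^2] is [`|g|^2] cut off to the complement of [K]. *)
apply: ge0_le_integral => //.
- by move=> x _; rewrite lee_fin sqr_ge0.
- by apply/measurable_EFinP; exact: measurable_normc_sq.
- apply/(measurable_restrictT _ (measurableC mK)).
  by apply: measurable_funTS; apply/measurable_EFinP; exact: measurable_normc_sq.
move=> x _; rewrite patchE.
rewrite -[sqfun_val _ x]/(g x - h x) /h /patch in_setC.
case: (x \in KB) => /=; last by rewrite subr0.
by rewrite subrr lee_fin normc0 expr0n.
Qed.
End translates.

(** * Almost orthogonal translates *)

Section almost_orthogonality.
Local Open Scope quotient_scope.
Context (R : realType) (G : topologicalZmodType) (mu : haarMeasure R G).
Context (L : zmodClosed G) (latL : is_lattice L) (infL : infinite_set [set` L]).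

(** The induction carries a representative [g] of the sum of translates and
    a compact set [C] outside of which [g] vanishes; [lattice_escape] provides
    the next translate, disjoint from [C]. *)
Lemma disjoint_translates (f : sqfun mu) (K : set G) (n : nat) :
  compact K -> (forall x, ~ K x -> f x = 0) ->
  exists2 B : {fset [set` L]}, #|` B| = n &
    L2norm (\sum_(k <- B) translates L (\pi_(L2 mu) f) k) ^+ 2 =
    n%:R * L2norm (\pi_(L2 mu) f) ^+ 2.
Proof.
move=> cK fK.
suff [B [g [C [Bn _ _ sumB gn]]]] : exists (B : {fset [set` L]}) (g : sqfun mu) (C : set G),
    [/\ #|` B| = n, compact C, (forall x, ~ C x -> g x = 0),
      \sum_(k <- B) translates L (\pi_(L2 mu) f) k = \pi_(L2 mu) g &
      L2norm (\pi_(L2 mu) g) ^+ 2 = n%:R * L2norm (\pi_(L2 mu) f) ^+ 2].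
  by exists B; rewrite ?sumB.
elim: n => [|n [B [g [C [Bn cC gC sumB gn]]]]].
  exists fset0, 0, set0; split=> //; first exact: compact0.
    by rewrite big_seq_fset0 raddf0.
  by rewrite raddf0 mul0r /L2norm normr0 expr0n.
have [k kB Ck] := lattice_escape latL infL B cC cK.
exists (k |` B)%fset, (sqfun_translate (\val k) f + g),
  ([set x + \val k | x in K] `|` C); split.
- by rewrite cardfsU1 kB Bn.
- apply: compactU => //; apply: continuous_compact cK.
  apply: continuous_subspaceT => x.
  apply: (@continuous_comp _ _ _ (fun x : G => (x, \val k)) (fun z => z.1 + z.2)).
    by apply: cvg_pair; [exact: cvg_id|exact: cvg_cst].
  exact: add_continuous.
- move=> x /not_orP[Kx Cx].
  rewrite -[LHS]/(f ((x : G) - \val k) + g x) gC// addr0 fK// => Kxk.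
  by apply: Kx; exists (x - \val k) => //; rewrite subrK.
- by rewrite big_fsetU1//= sumB raddfD /= /translates translate_pi.
rewrite L2norm_pythagoras => [|x].
  rewrite gn -translate_pi L2norm_translate -[n.+1%:R]natr1 mulrDl mul1r.
  by rewrite addrC.
have [Cx|Cx] := pselect (C x); [left|by right; exact: gC].
by apply: fK; exact: Ck.
Qed.

(** The compactly supported approximation of [psi] depends on [n] and [e], so
    that the [n] approximation errors add up to at most [e/2]. *)
Lemma almost_orthogonal_translates (hausdorffG : hausdorff_space G)
    (psi : L2 mu) (n : nat) (e : R) : 0 < e ->
  exists2 B : {fset [set` L]}, #|` B| = n &
    `|L2norm (\sum_(k <- B) translates L psi k) - Num.sqrt n%:R * L2norm psi|
      <= e.
Proof.
(* Both errors below are at most [n.+1 * d], since [n] and [sqrt n] are at most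
   [n.+1]; the successor keeps [d] meaningful for [n = 0]. *)
move=> e0; pose d := e / (2 * n.+1%:R).
have d0 : 0 < d by rewrite divr_gt0// mulr_gt0.
have [K [f [cK fK psif]]] := L2_compact_support_dense hausdorffG psi d0.
have [B Bn Bf] := disjoint_translates n cK fK.
exists B => //; set phi := \pi_(L2 mu) f in psif Bf.
have {Bf}Bf : L2norm (\sum_(k <- B) translates L phi k) =
    Num.sqrt n%:R * L2norm phi.
  rewrite -[LHS]ger0_norm ?L2norm_ge0// -sqrtr_sqr Bf sqrtrM// sqrtr_sqr.
  by rewrite ger0_norm ?L2norm_ge0.
have Bd : `|L2norm (\sum_(k <- B) translates L psi k) -
    Num.sqrt n%:R * L2norm phi| <= n.+1%:R * d.
  rewrite -Bf (le_trans (L2norm_dist _ _))// -sumrB.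
  rewrite (le_trans (L2norm_sum _ _))//.
  under eq_bigr do rewrite /translates -translateB L2norm_translate.
  rewrite big_const_seq count_predT iter_addr addr0 Bn -[leLHS]mulr_natl.
  by rewrite ler_pM// ?L2norm_ge0// ler_nat.
have sd : `|Num.sqrt n%:R * L2norm phi - Num.sqrt n%:R * L2norm psi|
    <= n.+1%:R * d.
  rewrite -mulrBr normrM distrC ger0_norm ?sqrtr_ge0// ler_pM ?sqrtr_ge0//.
    rewrite -[leRHS]ger0_norm// -sqrtr_sqr ler_wsqrtr//.
    by rewrite -natrX ler_nat (leq_trans (leqnSn n))// expnS leq_pmulr.
  exact: le_trans (L2norm_dist _ _) psif.
apply: le_trans (ler_distD (Num.sqrt n%:R * L2norm phi) _ _) _.
rewrite (le_trans (lerD Bd sd))//.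
have -> : n.+1%:R * d = e / 2.
  by rewrite /d invfM mulrCA [2^-1 * _]mulrC mulVKf// pnatr_eq0.
by rewrite -splitr.
Qed.
End almost_orthogonality.

(** * Democracy *)

(** The normalizing factors are all equal to [`|psi|^-1] and cancel; a positive
    constant of [R[i]] is real. *)
Lemma democratic_translatesP (R : realType) (G : topologicalZmodType)
    (mu : haarMeasure R G) (L : zmodClosed G) (psi : L2 mu) (psi0 : `|psi| != 0) :
  democratic (translates L psi) <->
  exists2 D : R, 0 < D & forall A B : {fset [set` L]}, #|` A| = #|` B| ->
    L2norm (\sum_(k <- A) translates L psi k) <=
      D * L2norm (\sum_(k <- B) translates L psi k).
Proof.
have normT k : `|translates L psi k| = `|psi|.
  by rewrite !normL2E /translates L2norm_translate.
have sumE (A : {fset [set` L]}) :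
    `|\sum_(k <- A) `|translates L psi k|^-1 *: translates L psi k| =
    `|psi|^-1 * `|\sum_(k <- A) translates L psi k|.
  under eq_bigr do rewrite normT.
  by rewrite -scaler_sumr normrZ normfV normr_id.
have psi_gt0 : 0 < `|psi| by rewrite lt_neqAle eq_sym psi0 normr_ge0.
split=> [[_ [D D0 DAB]]|[D D0 DAB]].
  have DE : D = (complex.Re D)%:C%C.
    by move: D0; case: D {DAB} => a b; rewrite ltcE/= => /andP[/eqP-> _].
  exists (complex.Re D); first by rewrite -ltcR -DE.
  move=> A B AB; rewrite -lecR rmorphM/= -DE -!normL2E.
  by have := DAB A B AB; rewrite !sumE mulrCA ler_pM2l// invr_gt0.
split=> [k|]; first by rewrite -normr_eq0 normT.
exists D%:C%C; first by rewrite ltcR.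
move=> A B AB; rewrite !sumE mulrCA ler_pM2l ?invr_gt0//.
by rewrite !normL2E -rmorphM lecR; exact: DAB.
Qed.

Theorem theorem1 (R : realType) (G : topologicalZmodType)
    (hausdorffG : hausdorff_space G) (lcG : locally_compact [set: G])
    (mu : haarMeasure R G) (L : zmodClosed G) (latL : is_lattice L)
    (countL : countable [set` L]) (infL : infinite_set [set` L])
    (psi : L2 mu) (psi0 : `|psi| != 0) :
  democratic (translates L psi) <->
  exists c C : R, [/\ 0 < c, 0 < C &
    forall Gamma : {fset [set` L]}, Gamma != fset0 ->
      (c * #|` Gamma|%:R)%:C%C <= `|\sum_(k <- Gamma) translates L psi k| ^+ 2
      <= (C * #|` Gamma|%:R)%:C%C].
Proof.
have N0 : 0 < L2norm psi.
  rewrite lt_neqAle L2norm_ge0 andbT eq_sym; apply: contra psi0.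
  by rewrite normL2E => /eqP->.
pose S (A : {fset [set` L]}) := L2norm (\sum_(k <- A) translates L psi k).
have S0 A : 0 <= S A by exact: L2norm_ge0.
have sqE (A : {fset [set` L]}) (a : R) : ((a%:C <= `|\sum_(k <- A) translates L psi k| ^+ 2)%C =
    (a <= S A ^+ 2)) * ((`|\sum_(k <- A) translates L psi k| ^+ 2 <= a%:C)%C =
    (S A ^+ 2 <= a)).
  by rewrite normL2E -rmorphXn !lecR.
rewrite democratic_translatesP//; split=> [[D D0 DAB]|[c [C [c0 C0 cC]]]].
  (* The error [`|psi| / 2] is at most half of [sqrt n * `|psi|] for [n > 0]. *)
  have test n : (0 < n)%N -> exists2 B : {fset [set` L]}, #|` B| = n &
      Num.sqrt n%:R * L2norm psi / 2 <= S B <= 2 * (Num.sqrt n%:R * L2norm psi).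
    move=> n0; have e0 : 0 < L2norm psi / 2 by rewrite divr_gt0.
    have [B Bn b] := almost_orthogonal_translates latL infL hausdorffG psi n e0.
    exists B => //.
    have s1 : L2norm psi <= Num.sqrt n%:R * L2norm psi.
      by rewrite ler_peMl ?L2norm_ge0// -[leLHS]sqrtr1 ler_wsqrtr// ler1n.
    move: b; rewrite -/(S B) ler_distl => /andP[? ?].
    by apply/andP; split; lra.
  set N := L2norm psi in N0 test.
  exists (N ^+ 2 / (4 * D ^+ 2)), (4 * D ^+ 2 * N ^+ 2); split.
  - by rewrite divr_gt0 ?mulr_gt0 ?exprn_gt0.
  - by rewrite ?mulr_gt0 ?exprn_gt0.
  move=> A A0; rewrite !sqE; have [|B Bn /andP[]] := test #|` A|.
    by rewrite cardfs_gt0.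
  have := DAB _ _ Bn; have := DAB _ _ (esym Bn); rewrite -/(S A) -/(S B).
  move=> AB BA lB uB.
  have n0 : (0 : R) <= #|` A|%:R by [].
  have lA : Num.sqrt #|` A|%:R * N / 2 <= D * S A by exact: le_trans BA.
  have uA : S A <= D * (2 * (Num.sqrt #|` A|%:R * N)).
    by apply: le_trans AB _; rewrite ler_pM2l.
  apply/andP; split.
  - rewrite mulrAC ler_pdivrMr ?mulr_gt0 ?exprn_gt0//.
    have : (Num.sqrt #|` A|%:R * N / 2) ^+ 2 <= (D * S A) ^+ 2.
      by rewrite lerXn2r ?nnegrE ?divr_ge0 ?mulr_ge0 ?sqrtr_ge0 ?(ltW N0) ?(ltW D0).
    by rewrite !exprMn sqr_sqrtr// => ?; lra.
  - have : S A ^+ 2 <= (D * (2 * (Num.sqrt #|` A|%:R * N))) ^+ 2.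
      by rewrite lerXn2r ?nnegrE ?mulr_ge0 ?sqrtr_ge0 ?(ltW N0) ?(ltW D0).
    by rewrite !exprMn sqr_sqrtr// => ?; lra.
exists (Num.sqrt (C / c)); first by rewrite sqrtr_gt0 divr_gt0.
move=> A B AB; rewrite -/(S A) -/(S B).
have [A0|A0] := eqVneq A fset0.
  have B0 : B = fset0 by apply/eqP; rewrite -cardfs_eq0 -AB A0.
  by rewrite /S A0 B0 big_seq_fset0 /L2norm normr0 mulr0.
have B0 : B != fset0 by rewrite -cardfs_gt0 -AB cardfs_gt0.
have := cC A A0; rewrite !sqE => /andP[_ uA].
have := cC B B0; rewrite !sqE -AB => /andP[lB _].
rewrite -(@ler_pXn2r _ 2) ?nnegrE ?mulr_ge0 ?sqrtr_ge0//.
rewrite exprMn sqr_sqrtr ?divr_ge0 ?(ltW c0) ?(ltW C0)//.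
rewrite (le_trans uA)// -mulrA ler_pM2l// ler_pdivlMl//.
Qed.
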